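(* Let $B$ be a square substochastic matrix. Then the spectral radius of $B$ is no larger than one. Moreover, the following statements are equivalent: (i) $\widehat{\operatorname{con}}\,B$ is finite. (ii) $B$ is convergent. (iii) $I-B$ is nonsingular.
   Context: A substochastic matrix is a real matrix $B=(b_{ij})$ with $b_{ij}\ge 0$ for all $i,j$ and $\sum_j b_{ij}\le 1$ for all $i$. A square matrix $B$ is convergent if $B^k\to 0$ as $k\to\infty$. For a square matrix $B$ of order $n$, its digraph has vertex set $\{1,\dots,n\}$ and an edge $i\to j$ if and only if $b_{ij}\neq 0$. A walk is a nonempty finite sequence of consecutive edges $i_1\to i_2\to\cdots\to i_\ell$ ($\ell\ge 2$) in the digraph; its length $|p|$ is the number of edges $\ell-1$, $\operatorname{head}p=i_1$ is its first vertex and $\operatorname{last}p=i_\ell$ its last vertex. Let $\hat J(B)=\{i:\sum_j b_{ij}<1\}$ and let $\hat P_i(B)$ be the set of walks $p$ in the digraph of $B$ with $\operatorname{head}p=i$ and $\operatorname{last}p\in\hat J(B)$. The index of contraction of $B$ is $$\widehat{\operatorname{con}}\,B=\max\Bigl(0,\ \sup_{i\notin\hat J(B)}\ \inf_{p\in\hat P_i(B)}|p|\Bigr),$$ where $i\notin\hat J(B)$ means $i\in\{1,\dots,n\}\setminus\hat J(B)$, and $\inf\emptyset=\infty$, $\sup\emptyset=-\infty$. *)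

(* Defs.v *)
From HB Require Import structures.
From mathcomp Require Import all_boot all_order all_algebra.
From mathcomp Require Import complex.
From mathcomp Require Import all_classical all_reals all_analysis.

Set Implicit Arguments.
Unset Strict Implicit.
Unset Printing Implicit Defensive.

Import Order.TTheory GRing.Theory Num.Theory.
Import numFieldNormedType.Exports.

Local Open Scope classical_set_scope.
Local Open Scope ring_scope.

Definition substochastic (R : realType) (n : nat) (B : 'M[R]_n) : Prop :=
  (forall i j, 0 <= B i j) /\ (forall i, \sum_j B i j <= 1).

Definition convergent (R : realType) (n : nat) (B : 'M[R]_n) : Prop :=
  (fun k : nat => B ^+ k) @ \oo --> (0 : 'M[R]_n).

Definition nonsingular (R : realType) (n : nat) (B : 'M[R]_n) : Prop :=
  B \in unitmx.

(* `eigenvalue` refers to left eigenvectors; a square matrix over a field has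
   the same left and right eigenvalues. *)
Definition spectrum (R : realType) (n : nat) (B : 'M[R]_n) : set R[i] :=
  [set z | eigenvalue (map_mx (real_complex R) B) z].

Definition spectral_radius (R : realType) (n : nat) (B : 'M[R]_n) : R :=
  sup [set ComplexField.Normc.normc z | z in spectrum B].

(* For n > 0 the supremum above is the least upper bound of the moduli, and not
   the default value that `sup` takes on unbounded or empty sets. When n = 0
   the spectrum is empty and the radius is 0. *)
Lemma spectral_radius_has_sup (R : realType) (n : nat) (B : 'M[R]_n) :
  (0 < n)%N ->
  has_sup [set ComplexField.Normc.normc z | z in spectrum B].
Proof.
move=> n0; set A := map_mx (real_complex R) B.
have [rs Ars] := closed_field_poly_normal (char_poly A).
move: Ars; rewrite (monicP (char_poly_monic A)) scale1r => Ars.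
have memE z : eigenvalue A z = (z \in rs).
  by rewrite eigenvalue_root_char Ars root_prod_XsubC.
split.
- have : (0 < size rs)%N.
    by have := size_char_poly A; rewrite Ars size_prod_XsubC => -[->].
  case: rs memE {Ars} => [//|z rs] memE _.
  exists (ComplexField.Normc.normc z), z => //.
  by rewrite /spectrum /= memE mem_head.
- exists (\sum_(z <- rs) ComplexField.Normc.normc z) => _ [z /= + <-].
  have ge0 (w : R[i]) : 0 <= ComplexField.Normc.normc w.
    by case: w => a b; rewrite /= sqrtr_ge0.
  rewrite /spectrum /= memE => zrs.
  by rewrite (big_rem z) //= lerDl sumr_ge0.
Qed.

Definition edge (R : realType) (n : nat) (B : 'M[R]_n) : rel 'I_n :=
  fun i j => B i j != 0.

(* The pair (i, s) stands for the vertex sequence i :: s, so that the number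
   of edges is the size of s. *)
Definition is_walk (R : realType) (n : nat) (B : 'M[R]_n)
    (p : 'I_n * seq 'I_n) : bool :=
  (0 < size p.2)%N && path (edge B) p.1 p.2.

Definition walk_head (n : nat) (p : 'I_n * seq 'I_n) : 'I_n := p.1.

Definition walk_last (n : nat) (p : 'I_n * seq 'I_n) : 'I_n := last p.1 p.2.

Definition walk_length (n : nat) (p : 'I_n * seq 'I_n) : nat := size p.2.

Definition hatJ (R : realType) (n : nat) (B : 'M[R]_n) : set 'I_n :=
  [set i | \sum_j B i j < 1].

Definition hatP (R : realType) (n : nat) (B : 'M[R]_n) (i : 'I_n) :
    set ('I_n * seq 'I_n) :=
  [set p | [/\ is_walk B p, walk_head p = i & hatJ B (walk_last p)]].

(* In \bar R, `ereal_inf set0` is +oo and `ereal_sup set0` is -oo. *)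
Definition hatcon (R : realType) (n : nat) (B : 'M[R]_n) : \bar R :=
  maxe 0%E
    (ereal_sup
       [set ereal_inf [set (walk_length p)%:R%:E | p in hatP B i]
          | i in ~` hatJ B]).

(* Main.v *)
(* The bound on the spectral radius is the l1 estimate for a left eigenvector.
   (i) => (iii): if B v = v, then an entry of maximal modulus propagates along
   edges and cannot be nonzero at a vertex of hatJ, so v = 0 when every vertex
   reaches hatJ.
   (iii) => (ii): the row sums of the powers of B decrease to a vector fixed by
   B, which is 0 when 1 - B is nonsingular, and they dominate the entries.
   (ii) => (i): if i does not reach hatJ, then the ith row sum of every power
   of B is 1. *)
Require Import Defs.
From HB Require Import structures.
From mathcomp Require Import all_boot all_order all_algebra.
From mathcomp Require Import complex.
From mathcomp Require Import all_classical all_reals all_analysis.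

Import Order.TTheory GRing.Theory Num.Theory.
Import numFieldNormedType.Exports.

Local Open Scope ring_scope.

Definition rowsum {R : realType} {n : nat} (B : 'M[R]_n) (k : nat)
    (i : 'I_n) : R :=
  \sum_j (B ^+ k) i j.

Lemma rowsum0 (R : realType) (n : nat) (B : 'M[R]_n) (i : 'I_n) :
  rowsum B 0 i = 1.
Proof.
rewrite /rowsum expr0 (bigD1 i) //= big1 => [|j /negPf ji].
  by rewrite addr0 mxE eqxx.
by rewrite mxE eq_sym ji.
Qed.

Lemma rowsumS (R : realType) (n : nat) (B : 'M[R]_n) (k : nat) (i : 'I_n) :
  rowsum B k.+1 i = \sum_j B i j * rowsum B k j.
Proof.
rewrite /rowsum; under eq_bigr do rewrite exprS mxE.
by rewrite exchange_big; apply: eq_bigr => j _; rewrite mulr_sumr.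
Qed.

(** A matrix has finitely many entries, so the eventual bounds on the single entries hold
    simultaneously from some rank on. *)
Lemma cvgn_mxP (R : realType) (m n : nat) (u : nat -> 'M[R]_(m, n))
    (A : 'M[R]_(m, n)) :
  (u @ \oo --> A)%classic <->
  forall i j, ((fun k => u k i j) @ \oo --> A i j)%classic.
Proof.
split=> [uA i j|uA].
  apply: (cvg_comp _ (fun M : 'M[R]_(m, n) => M i j) uA).
  exact: coord_continuous.
apply/cvg_ballP => e e0.
have H i j : (\forall k \near \oo, ball (A i j) e (u k i j))%classic.
  by move/cvg_ballP : (uA i j); apply.
near=> k.
split=> // i j; move: i j; near: k.
by apply: filter_forall => i; apply: filter_forall => j; exact: H.
Unshelve. all: by end_near. Qed.

Lemma expmx_ge0 (R : realType) (n : nat) (B : 'M[R]_n) (k : nat) :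
  (forall i j, 0 <= B i j) -> forall i j, 0 <= (B ^+ k) i j.
Proof.
move=> B0; elim: k => [|k IH] i j; first by rewrite expr0 mxE ler0n.
by rewrite exprS mxE sumr_ge0 // => l _; rewrite mulr_ge0.
Qed.

Lemma unitmx_ker0 (F : fieldType) (n : nat) (A : 'M[F]_n) :
  (A \in unitmx) <-> (forall v : 'cV[F]_n, A *m v = 0 -> v = 0).
Proof.
split=> [uA v Av|inj]; first by rewrite -(mulKmx uA v) Av mulmx0.
(* [kermx] is a left kernel while [inj] speaks of column vectors, hence the transposes. *)
rewrite -unitmx_tr -row_free_unit -kermx_eq0; apply/eqP/row_matrixP => i.
rewrite row0; apply: trmx_inj; rewrite trmx0; apply: inj.
apply: trmx_inj; rewrite trmx_mul trmxK trmx0; apply/sub_kermxP; exact: row_sub.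
Qed.

(** Summing [|z| |u_j| <= \sum_i |u_i| b_ij] over [j] and exchanging the sums leaves the row sums of
    [B], each at most 1, so [|z|] times the l1 norm of [u] is at most that norm. *)
Lemma normc_eigenvalue_le1 (R : realType) (n : nat) (B : 'M[R]_n) (z : R[i]) :
  substochastic B -> spectrum B z -> ComplexField.Normc.normc z <= 1.
Proof.
move=> [B0 B1] /eigenvalueP[u uB un0].
(* The norm on [R[i]] takes values in [R[i]]; it is the image of [normc]. *)
rewrite -lecR; change (`|z| <= 1).
have u0 : 0 < \sum_j `|u 0 j|.
  rewrite lt_neqAle sumr_ge0 // andbT eq_sym; apply: contra un0 => /eqP s0.
  apply/eqP/rowP => j; rewrite mxE; apply/eqP; rewrite -normr_eq0; apply/eqP.
  by apply: (psumr_eq0P _ s0).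
rewrite -(ler_pM2r u0) mul1r mulr_sumr.
have le j : `|z| * `|u 0 j| <= \sum_i `|u 0 i| * (real_complex R (B i j)).
  rewrite -normrM; have /matrixP/(_ 0 j) := uB; rewrite !mxE => <-.
  apply: (le_trans (ler_norm_sum _ _ _)); apply: ler_sum => i _.
  rewrite normrM mxE [`|real_complex R _|]ger0_norm //.
  by rewrite -(rmorph0 (real_complex R)) lecR.
apply: (le_trans (ler_sum _ (fun j _ => le j))).
rewrite exchange_big /=; apply: ler_sum => i _.
rewrite -mulr_sumr -rmorph_sum ler_piMr //.
by rewrite -[leRHS](rmorph1 (real_complex R)) lecR.
Qed.

(** With finitely many vertices, the supremum is below [+oo] as soon as each infimum is, and an
    infimum is [+oo] when there is no walk. [connect] also admits the empty path, which only matters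
    at vertices of [hatJ]. *)
Lemma hatcon_fin_numP (R : realType) (n : nat) (B : 'M[R]_n) :
  hatcon B \is a fin_num <->
  forall i, exists2 j, connect (edge B) i j & hatJ B j.
Proof.
rewrite /hatcon; set S := ereal_sup _.
(* The maximum with 0 rules out [-oo], including when the supremum is over the empty set. *)
have -> : (maxe 0 S \is a fin_num)%E = (S < +oo)%E.
  rewrite ge0_fin_numE; last by rewrite le_max lexx.
  by rewrite gt_max ltry.
split=> [Sfin i|reach].
- have [iJ|iJ] := pselect (hatJ B i); first by exists i.
  have [[p [/andP[_ pp] <- pJ]]|P0] := pselect (exists p, hatP B i p).
    by exists (walk_last p) => //; apply/connectP; exists p.2.
  suff : (+oo <= S)%E by rewrite leNgt Sfin.
  apply: ereal_sup_ubound; exists i => //.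
  rewrite (_ : hatP B i = set0)%classic ?image_set0 ?ereal_inf0 //.
  by apply/seteqP; split=> // p Pp; case: P0; exists p.
- have walk i : exists m : nat, (~` hatJ B)%classic i ->
    (ereal_inf [set ((walk_length p)%:R)%:E | p in hatP B i]%classic
       <= (m%:R : R)%:E)%E.
    have [j /connectP[s ps jl] jJ] := reach i.
    exists (size s) => iJ; apply: ereal_inf_lbound; exists (i, s) => //.
    split=> //; last by rewrite /walk_last /= -jl.
    (* A path from outside [hatJ] into [hatJ] has at least one edge. *)
    rewrite /is_walk /= ps andbT lt0n size_eq0; apply/eqP => s0.
    by apply: iJ; rewrite s0 /= in jl; rewrite -jl.
  have [m mP] := choice walk.
  (* The sum of the lengths serves as a common upper bound in place of their maximum. *)
  apply: (@le_lt_trans _ _ ((\sum_i m i)%:R)%:E); last exact: ltry.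
  apply: ge_ereal_sup => _ [i iJ <-]; apply: (le_trans (mP i iJ)).
  by rewrite lee_fin ler_nat (bigD1 i) //= leq_addr.
Qed.

Lemma reach_nonsingular (R : realType) (n : nat) (B : 'M[R]_n) :
  substochastic B -> (forall i, exists2 j, connect (edge B) i j & hatJ B j) ->
  nonsingular (1%:M - B).
Proof.
move=> [B0 B1] reach; apply/unitmx_ker0 => v /eqP.
rewrite mulmxBl mul1mx subr_eq0 => /eqP vE.
have vi i : `|v i 0| <= \sum_j B i j * `|v j 0|.
  rewrite {1}vE mxE; apply: (le_trans (ler_norm_sum _ _ _)).
  by apply: ler_sum => j _; rewrite normrM (ger0_norm (B0 i j)).
apply/colP => i0; rewrite [RHS]mxE; apply/eqP; rewrite -normr_eq0.
pose i1 := [arg max_(i > i0) `|v i 0|]%O.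
have M i : `|v i 0| <= `|v i1 0|.
  by rewrite /i1; case: arg_maxP => // k _; apply.
rewrite eq_le normr_ge0 andbT; apply: (le_trans (M i0)).
(* At a vertex of maximal modulus both parts of this expression are nonpositive, so both vanish: the
   second excludes [hatJ], the first forces maximal modulus at every successor. *)
have bound i : `|v i 0| = `|v i1 0| ->
    0 <= \sum_j B i j * (`|v j 0| - `|v i1 0|) - (1 - \sum_j B i j) * `|v i1 0|.
  move=> iM; have := vi i; rewrite iM -subr_ge0 => /le_trans; apply.
  under [in leRHS]eq_bigr do rewrite mulrBr.
  by rewrite sumrB -mulr_suml mulrBl mul1r opprB addrA subrK.
have [|Mpos] := leP (`|v i1 0|) 0; first by [].
have step i : `|v i 0| = `|v i1 0| ->
    ~ hatJ B i /\ forall j, edge B i j -> `|v j 0| = `|v i1 0|.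
  move=> /bound; rewrite subr_ge0 => h.
  have neg j : B i j * (`|v j 0| - `|v i1 0|) <= 0.
    by rewrite mulr_ge0_le0 // subr_le0.
  have s0 : \sum_j B i j * (`|v j 0| - `|v i1 0|) <= 0 by exact: sumr_le0.
  split=> [iJ|j eij].
    have := le_trans h s0; rewrite pmulr_lle0 // subr_le0 => h'.
    by have := le_lt_trans h' iJ; rewrite ltxx.
  apply/eqP; rewrite -subr_eq0.
  suff /eqP : B i j * (`|v j 0| - `|v i1 0|) = 0.
    by rewrite mulf_eq0 (negPf eij).
  apply/eqP; rewrite eq_le neg /= -oppr_le0.
  have : 0 <= \sum_j B i j * (`|v j 0| - `|v i1 0|).
    by apply: le_trans h; rewrite mulr_ge0 // subr_ge0.
  rewrite (bigD1 j) //= => h2; rewrite oppr_le0; apply: (le_trans h2).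
  by rewrite gerDl sumr_le0.
have [j /connectP[s ps ->]] := reach i1.
suff : forall i, `|v i 0| = `|v i1 0| -> path (edge B) i s ->
    ~ hatJ B (last i s).
  by move=> /(_ i1 erefl ps).
elim: s {ps} => [|k s IH] i /step[iJ iE] //= /andP[ik].
by apply: IH; exact: iE.
Qed.

Lemma nonsingular_convergent (R : realType) (n : nat) (B : 'M[R]_n) :
  substochastic B -> nonsingular (1%:M - B) -> convergent B.
Proof.
move=> [B0 B1] /unitmx_ker0 ns.
have r0 k i : 0 <= rowsum B k i by apply: sumr_ge0 => j _; exact: expmx_ge0.
(* A nonnegative [B] preserves the entrywise order, so the first inequality, which is [B1],
   propagates to all [k]. *)
have rdec k : forall i, rowsum B k.+1 i <= rowsum B k i.
  elim: k => [|k IH] i.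
    rewrite rowsumS rowsum0; under eq_bigr do rewrite rowsum0 mulr1.
    exact: B1.
  by rewrite !rowsumS; apply: ler_sum => j _; exact: ler_wpM2l.
have rcvg i : cvgn (fun k => rowsum B k i).
  apply: nonincreasing_is_cvgn.
    by apply/nonincreasing_seqP => k; exact: rdec.
  by exists 0 => _ [k _ <-].
pose v : 'cV[R]_n := \col_i limn (fun k => rowsum B k i).
have rv i : ((fun k => rowsum B k i) @ \oo --> v i 0)%classic.
  by rewrite mxE; exact: rcvg.
have v0 : v = 0.
  apply: ns; rewrite mulmxBl mul1mx; apply/eqP; rewrite subr_eq0.
  apply/eqP/colP => i.
  (* The shifted sequence has the same limit, so passing to the limit in [rowsumS] gives
     [v = B v]. *)
  have h1 : ((fun k => rowsum B k.+1 i) @ \oo --> v i 0)%classic.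
    by rewrite (cvg_shiftS (fun k => rowsum B k i)); exact: rv.
  rewrite [RHS]mxE; apply: (cvg_unique _ h1) => //.
  rewrite (_ : (fun k => _) = (fun k => \sum_j B i j * rowsum B k j)).
    2: by apply/funext => k; exact: rowsumS.
  apply: cvg_big => [|j _]; first exact: add_continuous.
  by apply: cvgM; [exact: cvg_cst | exact: rv].
apply/cvgn_mxP => i j; rewrite mxE.
apply: (squeeze_cvgr (f := fun=> 0) (h := fun k => rowsum B k i)).
- near=> k; rewrite expmx_ge0 //= /rowsum (bigD1 j) //= lerDl.
  by apply: sumr_ge0 => l _; exact: expmx_ge0.
- exact: cvg_cst.
- by have := rv i; rewrite v0 mxE.
Unshelve. all: by end_near. Qed.

Lemma convergent_reach (R : realType) (n : nat) (B : 'M[R]_n) :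
  substochastic B -> convergent B ->
  forall i, exists2 j, connect (edge B) i j & hatJ B j.
Proof.
move=> [B0 B1] /cvgn_mxP cB i; apply: contrapT => nreach.
(* The vertices reachable from [i] are closed under edges and avoid [hatJ], so their rows sum to 1
   and involve only reachable vertices. *)
have r1 k : forall j, connect (edge B) i j -> rowsum B k j = 1.
  elim: k => [|k IH] j ij; first exact: rowsum0.
  have : \sum_l B j l = 1.
    apply/eqP; rewrite eq_le B1 /= leNgt; apply/negP => jJ.
    by apply: nreach; exists j.
  rewrite rowsumS => <-; apply: eq_bigr => l _.
  have [->|jl] := eqVneq (B j l) 0; first by rewrite mul0r.
  by rewrite IH ?mulr1 //; apply: connect_trans ij _; exact: connect1.
have h : ((fun k => rowsum B k i) @ \oo -->
    \sum_(j < n) (0 : 'M[R]_n) i j)%classic.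
  by apply: cvg_big => [|j _]; [exact: add_continuous | exact: cB].
have h1 : ((fun k => rowsum B k i) @ \oo --> (1 : R))%classic.
  rewrite (_ : (fun k => _) = (fun=> 1)); first exact: cvg_cst.
  by apply/funext => k; exact/r1/connect0.
have : 1 = \sum_(j < n) (0 : 'M[R]_n) i j by apply: cvg_unique h1 h.
rewrite big1 => [/eqP|j _]; last by rewrite mxE.
by rewrite oner_eq0.
Qed.

Theorem corollary2p6 (R : realType) (n : nat) (B : 'M[R]_n)
    (hB : substochastic B) :
  spectral_radius B <= 1 /\
  [<-> hatcon B \is a fin_num; convergent B; nonsingular (1%:M - B)].
Proof.
split.
  rewrite /spectral_radius; set S := (X in sup X).
  (* On an empty spectrum [sup] takes the value 0. *)
  have [->|/set0P S0] := eqVneq S set0; first by rewrite sup0.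
  by apply: ge_sup S0 _ => _ [z Bz <-]; exact: normc_eigenvalue_le1 Bz.
(* The three implications form a cycle opposite to the one [tfae] asks for, so each of its goals is
   a composite of two. *)
have con_ns : hatcon B \is a fin_num -> nonsingular (1%:M - B).
  by move=> /hatcon_fin_numP; exact: reach_nonsingular.
have cv_con : convergent B -> hatcon B \is a fin_num.
  by move=> cB; apply/hatcon_fin_numP; exact: convergent_reach.
have ns_cv := nonsingular_convergent _ _ _ hB.
tfae; first by move=> /con_ns /ns_cv.
- by move=> /cv_con /con_ns.
- by move=> /ns_cv /cv_con.
Qed.
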